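(* Let $X = (X_{ij})_{i,j}$ be a symmetric $n \times n$ random matrix. Let $N := n(n+1)/2$ and assume that the common distribution of the entries $(X_{ij})_{i \le j}$ on $\mathbb{R}^N$ is given by $\mathbb{P}_\kappa$ for some $L \ge 2$, $\kappa$ and $\mathcal{X}$. Let $\lambda_{\max} := \lambda_{\max}(X) := \max \{|\lambda| : \lambda \text{ eigenvalue of } X\}$. Then for any $t \ge 0$, $$\mathbb{P}\big(|\lambda_{\max}(X) - \mathrm{med}(\lambda_{\max}(X))| \ge t\big) \le 4 \exp\Big( - \frac{t^2}{144 |\mathcal{X}|^2} \Big),$$ where $\mathrm{med}(\lambda_{\max}(X))$ is a median of $\lambda_{\max}(X)$.
   Context: Let $L \ge 2$ be an integer, $\kappa = (\kappa_1,\ldots,\kappa_L)$ a vector of positive integers with $\kappa_1 + \cdots + \kappa_L = N$, and $\mathcal{X} = \{x_1,\ldots,x_L\} \subset \mathbb{R}$ a set of $L$ distinct reals with $x_1 < \cdots < x_L$; $|\mathcal{X}| := x_L - x_1$. The multislice is $\Omega_\kappa = \{\omega \in \mathcal{X}^N : \#\{i : \omega_i = x_\ell\} = \kappa_\ell \text{ for } \ell = 1,\ldots,L\}$, and $\mathbb{P}_\kappa$ is the uniform distribution on $\Omega_\kappa$. *)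

(* Defs.v *)
From mathcomp Require Import all_boot all_order all_algebra.
From mathcomp Require Import finmap.
From mathcomp Require Import all_classical all_reals all_analysis.
Set Implicit Arguments.
Unset Strict Implicit.
Unset Printing Implicit Defensive.
Import Order.TTheory GRing.Theory Num.Theory.
Local Open Scope classical_set_scope.
Local Open Scope ring_scope.

Definition multislice {R : realType} {L N : nat}
    (kappa : L.-tuple nat) (x : L.-tuple R) : set (N.-tuple R) :=
  [set w : N.-tuple R | all (mem x) w /\
     forall l : 'I_L, count_mem (tnth x l) w = tnth kappa l].

(* See finite_multislice and multislice_neq0: neither the default value of
   fset_set on infinite sets nor a division by 0 ever comes into play. *)
Definition multislice_prob {R : realType} {L N : nat}
    (kappa : L.-tuple nat) (x : L.-tuple R) (A : set (N.-tuple R)) : \bar R :=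
  (#|` fset_set (A `&` multislice kappa x)|%:R /
   #|` fset_set (multislice (N := N) kappa x)|%:R)%:E.

(* |X| = x_L - x_1, for x sorted increasingly. *)
Definition spread {R : realType} {L : nat} (x : L.-tuple R) : R :=
  last 0 x - head 0 x.

Definition upper_index_seq (n : nat) : seq ('I_n * 'I_n) :=
  enum [pred p : 'I_n * 'I_n | (p.1 <= p.2)%N].

Lemma size_upper_index n : size (upper_index_seq n) == ((n * (n + 1)) %/ 2)%N.
Proof.
rewrite -cardE -sum1_card.
rewrite -(pair_big_dep xpredT (fun i j : 'I_n => (i <= j)%N) (fun _ _ => 1%N)) /=.
rewrite (exchange_big_dep xpredT) //=.
have E (j : 'I_n) : (\sum_(i < n | (i <= j)%N) 1 = j.+1)%N.
  have : (\sum_(i < j.+1) 1 = \sum_(i < n | i < j.+1) 1)%N.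
    exact: (big_ord_widen n (fun _ => 1%N)).
  by rewrite big_const_ord iter_addn_0 mul1n => ->; apply: eq_bigl => i; rewrite ltnS.
under eq_bigr do rewrite E.
rewrite -(big_mkord xpredT (fun i => i.+1)) -(big_add1 _ _ 0 n.+1 xpredT id) /=.
have := triangular_sum n.+1; rewrite big_ltn // add0n => ->.
by rewrite bin2 /= divn2 addn1 mulnC.
Qed.

Definition upper_index (n : nat) : ((n * (n + 1)) %/ 2).-tuple ('I_n * 'I_n) :=
  Tuple (size_upper_index n).

(* (X_ij)_{i <= j} as a vector in R^N; the chosen enumeration of the pairs
   i <= j is irrelevant for laws invariant under permutation of coordinates. *)
Definition upper_entries {R : realType} {n : nat} (A : 'M[R]_n) :
    ((n * (n + 1)) %/ 2).-tuple R :=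
  map_tuple (fun p => A p.1 p.2) (upper_index n).

(* For a symmetric A (with n > 0) the eigenvalues are all real and form a
   finite nonempty set, so that this sup is a max. *)
Definition lambda_max {R : realType} {n : nat} (A : 'M[R]_n) : R :=
  sup [set `|a| | a in [set a : R | eigenvalue A a]].

Definition is_median {R : realType} {d : measure_display}
    {T : measurableType d} (P : probability T R) (Z : T -> R) (m : R) : Prop :=
  ((2^-1)%:E <= P [set w | (Z w <= m)%R])%E /\
  ((2^-1)%:E <= P [set w | (m <= Z w)%R])%E.

Lemma finite_multislice (R : realType) (L N : nat) (kappa : L.-tuple nat)
  (x : L.-tuple R) : finite_set (multislice (N := N) kappa x).
Proof.
pose f (g : {ffun 'I_N -> 'I_L}) : N.-tuple R := [tuple tnth x (g i) | i < N].
apply: (@sub_finite_set _ _ (f @` setT)); last first.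
  by apply: finite_image; exact: finite_finset.
move=> w [/allP xw _].
have h i : exists l, tnth w i = tnth x l.
  by apply/tnthP; apply: xw; exact: mem_tnth.
exists [ffun i => projT1 (cid (h i))] => //.
apply: eq_from_tnth => i; rewrite tnth_mktuple ffunE.
by case: (cid (h i)).
Qed.

Lemma multislice_neq0 (R : realType) (L N : nat) (kappa : L.-tuple nat)
    (x : L.-tuple R) :
  uniq x -> sumn kappa = N -> multislice (N := N) kappa x !=set0.
Proof.
move=> ux <-.
pose s := flatten [seq nseq (tnth kappa l) (tnth x l) | l <- enum 'I_L].
have ss : size s == sumn kappa.
  rewrite size_flatten /shape -map_comp.
  rewrite -[in X in _ == X](map_tnth_enum kappa); apply/eqP; congr sumn.
  by apply: eq_map => l /=; rewrite size_nseq.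
exists (Tuple ss); split => /=.
  apply/allP => y /flattenP [_ /mapP [l _ ->]].
  by rewrite mem_nseq => /andP[_ /eqP ->]; exact: mem_tnth.
move=> l; rewrite count_flatten -map_comp sumnE big_map big_enum /=.
rewrite (bigD1 l) //= count_nseq /= eqxx mul1n big1 ?addn0 // => i il.
rewrite count_nseq /= (_ : _ == _ = false) ?mul0n //.
by apply/negbTE; apply: contra il => /eqP /(tuple_uniqP _ ux) ->.
Qed.

(* Main.v *)
Require Import Defs.
From mathcomp Require Import all_boot all_order all_fingroup all_algebra.
From mathcomp Require Import finmap.
From mathcomp Require Import all_classical all_reals all_analysis.
From mathcomp Require Import zify ring lra.
Set Implicit Arguments.
Unset Strict Implicit.
Unset Printing Implicit Defensive.
Import Order.TTheory GRing.Theory Num.Theory.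
Import numFieldNormedType.Exports.
Local Open Scope ring_scope.

(** Put the uniform law on the symmetric group 'S_N, with N the number of
    entries on and above the diagonal.  If a is any point of the multislice,
    the vector a o s, for a uniform permutation s, is uniform on the
    multislice ([multislice_probE]), so the statement is about the function
    Z(s) = lambda_max(M(s)) of s, where M(s) is the symmetric matrix filled
    with a o s.

    The probabilistic input is Talagrand's convex distance inequality for
    permutations.  For a nonempty A and a permutation s, let D(s) be the
    minimum, over probability weights mu on A, of sum_l mu(t : t l != s l)^2.
    Then the mean of exp(D / 32) is at most 1 / P(A), which gives
    P(A) P(D >= r) <= exp(- r / 32) ([perm_talagrand]).

    The proof is by induction on N, conditioning on the value of s at one
    position z ([kernel_bound_step]).  Let A_i be the part of A with value i
    at z, and let j maximise the size of A_j.  If s has value i at z, then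
    (i j) s has value j at z, and one mixes, with weights 1 - l and l, good
    weights on A_i for s and good weights on A_j for (i j) s.  The mismatch
    vector of the mixture is the mixture of the two mismatch vectors, except
    for an excess of at most l at the two positions where s and (i j) s
    differ: z, and the position k at which s takes the value j.  At z both
    vectors vanish and the excess costs l^2, but at k the square of a sum
    would produce a term linear in l, which the induction cannot absorb.  The
    remedy is to prove a stronger statement, in which one chosen coordinate is
    counted twice: 2 x^2 + 2 l^2 >= (x + l)^2 pays for an excess at the chosen
    coordinate by a term quadratic in l.  In the step the chosen coordinate is
    z, while the induction hypothesis is used with k chosen.  As k depends on
    s, this needs the inequality with a chosen value (j) rather than a chosen
    position; inversion of permutations exchanges the two forms
    ([kernel_bound_inv]).  Hoelder's inequality and a suitable l for each i
    ([interpolation_weight]) then close the induction.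

    The geometric input is that lambda_max is the maximum of |v M v^T| over
    unit vectors v ([lambda_max_qform]), hence a convex function, and
    1-Lipschitz for the Frobenius norm.  If Z <= u on A and Z(s) >= u + d, the
    mu-average K of the matrices M(t), t in A, satisfies |v K v^T| <= u for all
    unit v, so M(s) - K has Frobenius norm at least d.  Each entry of M(s) - K
    is at most the spread of x times the matching entry of the mismatch
    vector, and every entry of the vector fills at most two entries of the
    matrix, so that D(s) >= d^2 / (2 spread^2) ([perm_lambda_max_tail]).  With
    u = m and with u + d = m, and because both half-lines bounded by a median
    have probability at least 1/2, each tail is at most
    2 exp(- t^2 / (64 spread^2)). *)

(** * Two scalar inequalities *)

(** The weight of the mixture as a function of the ratio r of the sizes of two
    pieces of A: after Hoelder's inequality the logarithm of the ratio costs
    (1 - l) (- ln r), the mixture itself costs l^2 / 8, and 2 - r is what can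
    be summed over all pieces.  For r = 0 the first piece is empty, and the
    mixture must give it no weight. *)
Lemma interpolation_weight (R : realType) (r : R) : 0 <= r <= 1 ->
  exists2 l : R, 0 <= l <= 1 &
    (r = 0 -> l = 1) /\ (1 - l) * - ln r + l ^+ 2 / 8 <= ln (2 - r).
Proof.
move=> /andP[r0 r1].
have lnge (x : R) : 0 < x -> 1 - x^-1 <= ln x.
  move=> x0; have := @le_ln1Dx R (x^-1 - 1); rewrite subrKC lnV ?posrE//.
  by have := x0; rewrite -invr_gt0 => ?; lra.
have ge2 : 1 - (2 - r)^-1 <= ln (2 - r) by apply: lnge; lra.
(* Only ln y >= 1 - 1 / y is used.  With this estimate the slope 4 is the one
   that makes the terms of second order in 1 - r cancel. *)
have [r34|r34] := leP r (3 / 4); last first.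
  exists (4 * (1 - r)); first by apply/andP; split; lra.
  split; first by lra.
  apply: le_trans ge2.
  have ge3 : 1 - r^-1 <= ln r by apply: lnge; lra.
  apply: (@le_trans _ _ ((1 - 4 * (1 - r)) * (r^-1 - 1) + (4 * (1 - r)) ^+ 2 / 8)).
    by rewrite lerD2r ler_wpM2l //; lra.
  rewrite -subr_ge0.
  have -> : 1 - (2 - r)^-1 - ((1 - 4 * (1 - r)) * (r^-1 - 1) + (4 * (1 - r)) ^+ 2 / 8)
    = (1 - r) ^+ 2 * (4 * (1 - r) + 2 * (1 - r) ^+ 2) / (r * (2 - r)).
    by field; apply/andP; split; lra.
  rewrite divr_ge0//; first by rewrite mulr_ge0 ?sqr_ge0// addr_ge0 ?mulr_ge0 ?sqr_ge0//; lra.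
  by rewrite mulr_ge0//; lra.
exists 1; first by rewrite ler01 lexx.
split=> //; rewrite subrr mul0r add0r expr1n.
apply: le_trans ge2; have : (2 - r)^-1 <= (5/4)^-1 by rewrite lef_pV2 ?posrE; lra.
lra.
Qed.

(** Hoelder's inequality for exponentials, obtained from the convexity of exp
    after normalising both sums by their bounds. *)
Lemma log_convex_sum (R : realType) (I : finType) (f g : I -> R) (K1 K2 l : R) :
  0 <= l <= 1 -> 0 < K1 -> 0 < K2 ->
  (l != 1 -> \sum_i expR (f i) <= K1) -> \sum_i expR (g i) <= K2 ->
  \sum_i expR ((1 - l) * f i + l * g i) <= expR ((1 - l) * ln K1 + l * ln K2).
Proof.
move=> /andP[l0 l1] K10 K20 H1 H2.
have step i : expR ((1 - l) * f i + l * g i) <=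
   expR ((1 - l) * ln K1 + l * ln K2) * ((1 - l) * (expR (f i) / K1) + l * (expR (g i) / K2)).
  have -> : (1 - l) * f i + l * g i = ((1 - l) * ln K1 + l * ln K2) +
     ((1 - l) * (f i - ln K1) + l * (g i - ln K2)) by ring.
  rewrite expRD ler_wpM2l ?expR_ge0//.
  have := @convex_expR R (Itv01 l0 l1) (g i - ln K2) (f i - ln K1).
  rewrite !convRE /= /unstable.onem !expRD !expRN !lnK ?posrE//.
  by move=> H; rewrite mulrC [leRHS]addrC.
apply: le_trans (ler_sum _ (fun i _ => step i)) _.
rewrite -mulr_sumr -[leRHS]mulr1 ler_wpM2l ?expR_ge0//.
rewrite big_split /= -!mulr_sumr -!mulr_suml.
have A2 : (\sum_i expR (g i)) / K2 <= 1 by rewrite ler_pdivrMr ?mul1r.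
have [->|ln1] := eqVneq l 1; first by rewrite subrr mul0r add0r mul1r.
have A1 : (\sum_i expR (f i)) / K1 <= 1 by rewrite ler_pdivrMr ?mul1r ?H1.
rewrite -[leRHS](subrK l) lerD//.
  by rewrite -[leRHS]mulr1 ler_wpM2l//; lra.
by rewrite -[leRHS]mulr1 ler_wpM2l//; lra.
Qed.

(** * Weights on permutations and the mismatch vector *)

Definition prob_on (R : realType) (T : finType) (A : {set T}) (mu : T -> R) :=
  [/\ forall t, 0 <= mu t, forall t, t \notin A -> mu t = 0 & \sum_t mu t = 1].

Definition push (R : realType) (T U : finType) (f : T -> U) (mu : T -> R) (u : U) : R :=
  \sum_(t | f t == u) mu t.

(** The mismatch vector, weighing by mu the permutations that disagree with s
    at a position.  As mu ranges over the probability weights on A, these are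
    the points of the convex hull that defines Talagrand's convex distance from
    s to A. *)
Definition miss (R : realType) (N : nat) (mu : 'S_N -> R) (s : 'S_N) (l : 'I_N) : R :=
  \sum_(t : 'S_N | t l != s l) mu t.

(** The squared norm with the coordinate z counted twice: the second copy of
    u z pays for a later perturbation of this coordinate. *)
Definition cost (R : realType) (N : nat) (z : 'I_N) (u : 'I_N -> R) : R :=
  \sum_l u l ^+ 2 + u z ^+ 2.

Lemma sum_push (R : realType) (T U : finType) (f : T -> U) (mu : T -> R) (Q : pred U) :
  \sum_(u | Q u) push f mu u = \sum_(t | Q (f t)) mu t.
Proof.
rewrite (partition_big f Q)//=; apply: eq_bigr => u Qu.
by apply: eq_bigl => t; case: eqP => [->|]; rewrite ?Qu ?andbF.
Qed.

Lemma prob_on_push (R : realType) (T U : finType) (f : T -> U) (mu : T -> R)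
    (A : {set T}) (B : {set U}) :
  (forall t, t \in A -> f t \in B) -> prob_on A mu -> prob_on B (push f mu).
Proof.
move=> AB [mu0 muA mu1]; split; first by move=> u; apply: sumr_ge0.
- move=> u uB; apply: big1 => t /eqP ftu; apply: muA.
  by apply: contra uB => /AB; rewrite ftu.
- by rewrite sum_push.
Qed.

Lemma prob_on_mix (R : realType) (T : finType) (A : {set T}) (mu nu : T -> R) (l : R) :
  0 <= l <= 1 -> (l != 1 -> prob_on A mu) -> prob_on A nu ->
  prob_on A (fun t => (1 - l) * mu t + l * nu t).
Proof.
move=> /andP[l0 l1] Hmu [nu0 nuA nu1].
have [->|/Hmu[mu0 muA mu1]] := eqVneq l 1.
  have E t : (1 - 1) * mu t + 1 * nu t = nu t by rewrite subrr mul0r add0r mul1r.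
  split=> [t|t tA|]; [by rewrite E | by rewrite E nuA |].
  by under eq_bigr do rewrite E.
split=> [t|t tA|]; first by rewrite addr_ge0 ?mulr_ge0// subr_ge0.
  by rewrite muA// nuA// !mulr0 addr0.
by rewrite big_split /= -!mulr_sumr mu1 nu1 !mulr1 subrK.
Qed.

Lemma miss_ge0 (R : realType) N (mu : 'S_N -> R) s l :
  (forall t, 0 <= mu t) -> 0 <= miss mu s l.
Proof. by move=> mu0; apply: sumr_ge0. Qed.

Lemma miss_le1 (R : realType) N (A : {set 'S_N}) (mu : 'S_N -> R) s l :
  prob_on A mu -> miss mu s l <= 1.
Proof.
move=> [mu0 _ <-]; rewrite /miss big_mkcond /=; apply: ler_sum => t _.
by case: ifP.
Qed.

Lemma miss_mix (R : realType) N (mu nu : 'S_N -> R) (l : R) s k :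
  miss (fun t => (1 - l) * mu t + l * nu t) s k = (1 - l) * miss mu s k + l * miss nu s k.
Proof. by rewrite /miss big_split /= -!mulr_sumr. Qed.

(** A permutation t agrees with s at l exactly when their inverses agree at
    s l, so inversion only relabels positions as values. *)
Lemma miss_invg (R : realType) N (mu : 'S_N -> R) (s : 'S_N) l :
  miss (fun t => mu t^-1%g) s l = miss mu s^-1%g (s l).
Proof.
rewrite /miss (reindex_inj invg_inj) /=; apply: eq_big => [t|t _]; last by rewrite invgK.
rewrite permK; congr negb.
by rewrite -[in LHS](inj_eq (@perm_inj _ t)) permKV eq_sym.
Qed.

Lemma lift_perm_bij n (z : 'I_n.+1) :
  bijective (fun p : 'I_n.+1 * 'S_n => lift_perm z p.1 p.2).
Proof.
apply: inj_card_bij => [[i s] [j t] /= E|]; last first.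
  by rewrite card_prod card_ord !card_Sn factS.
have ij : i = j by rewrite -(lift_perm_id z i s) E lift_perm_id.
rewrite -ij in E *; congr pair; apply/permP => k.
by apply: (@lift_inj _ i); rewrite -!(lift_perm_lift z) E.
Qed.

(** Composition with the transposition (i j) carries the permutations with
    value i at z to those with value j at z; read on the smaller symmetric
    group it is a bijection. *)
Lemma lift_perm_tperm n (z i j : 'I_n.+1) : exists f : 'S_n -> 'S_n,
  bijective f /\ forall r, lift_perm z j (f r) = (lift_perm z i r * tperm i j)%g.
Proof.
have [g fK gK] := lift_perm_bij z.
pose f i j (r : 'S_n) := (g (lift_perm z i r * tperm i j)%g).2.
have fE i' j' r : lift_perm z j' (f i' j' r) = (lift_perm z i' r * tperm i' j')%g.
  rewrite -[RHS]gK /f; congr lift_perm.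
  have /(congr1 (fun s : 'S__ => s z)) := gK (lift_perm z i' r * tperm i' j')%g.
  by rewrite /= lift_perm_id permM lift_perm_id tpermL.
have fI i' j' r : f j' i' (f i' j' r) = r.
  have /(congr1 g) : lift_perm z i' (f j' i' (f i' j' r)) = lift_perm z i' r.
    by rewrite !fE (tpermC j') -mulgA tperm2 mulg1.
  by rewrite (fK (i', _)) (fK (i', _)) => -[].
by exists (f i j); split=> //; exists (f j i).
Qed.

Lemma miss_push_lift (R : realType) n (z i : 'I_n.+1) (mu : 'S_n -> R) (r : 'S_n) l :
  miss (push (lift_perm z i) mu) (lift_perm z i r) (lift z l) = miss mu r l.
Proof.
rewrite /miss sum_push; apply: eq_bigl => t.
by rewrite !lift_perm_lift (inj_eq lift_inj).
Qed.

Lemma miss_push_lift_id (R : realType) n (z i : 'I_n.+1) (mu : 'S_n -> R) (r : 'S_n) :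
  miss (push (lift_perm z i) mu) (lift_perm z i r) z = 0.
Proof. by rewrite /miss sum_push big1// => t; rewrite !lift_perm_id eqxx. Qed.

Lemma sqr_convex (R : realType) (l a b : R) : 0 <= l <= 1 ->
  ((1 - l) * a + l * b) ^+ 2 <= (1 - l) * a ^+ 2 + l * b ^+ 2.
Proof.
move=> /andP[l0 l1]; rewrite -subr_ge0.
have -> : (1 - l) * a ^+ 2 + l * b ^+ 2 - ((1 - l) * a + l * b) ^+ 2 =
  l * (1 - l) * (a - b) ^+ 2 by ring.
by rewrite mulr_ge0 ?sqr_ge0// mulr_ge0// subr_ge0.
Qed.

(** The inequality that makes the induction work.  The vector s is a mixture of
    u and w up to an excess of l at the two coordinates z and k.  Since u and w
    have the coordinate k counted twice, (x + l)^2 <= 2 x^2 + 2 l^2 turns the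
    excess at k into a quadratic cost; at z there is only the excess, so that
    counting z twice costs 2 l^2 as well. *)
Lemma cost_mix (R : realType) n (z : 'I_n.+1) (k : 'I_n) (u w : 'I_n -> R)
    (s : 'I_n.+1 -> R) (l : R) : 0 <= l <= 1 ->
  0 <= s z <= l ->
  (forall i, i != k -> s (lift z i) = (1 - l) * u i + l * w i) ->
  0 <= s (lift z k) <= (1 - l) * u k + l * w k + l ->
  cost z s <= (1 - l) * cost k u + l * cost k w + 4 * l ^+ 2.
Proof.
move=> l01 /andP[z0 zl] sE /andP[k0 kl]; rewrite /cost.
rewrite (bigD1_ord z) //= (bigD1 k)//=.
rewrite [\sum_i u i ^+ 2](bigD1 k)//=.
rewrite [\sum_i w i ^+ 2](bigD1 k)//=.
have le_rest : \sum_(i < n | i != k) s (lift z i) ^+ 2 <=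
   (1 - l) * \sum_(i < n | i != k) u i ^+ 2 + l * \sum_(i < n | i != k) w i ^+ 2.
  rewrite !mulr_sumr -big_split /=; apply: ler_sum => i ik.
  by rewrite sE// sqr_convex.
have le_z : s z ^+ 2 <= l ^+ 2 by rewrite lerXn2r ?nnegrE//; case/andP: l01.
have le_k : s (lift z k) ^+ 2 <= 2 * ((1 - l) * u k ^+ 2 + l * w k ^+ 2) + 2 * l ^+ 2.
  apply: (@le_trans _ _ (((1 - l) * u k + l * w k + l) ^+ 2)).
    by rewrite lerXn2r ?nnegrE// (le_trans k0).
  have := sqr_convex (u k) (w k) l01; move: ((1 - l) * u k + l * w k) => X.
  have := sqr_ge0 (X - l); nra.
nra.
Qed.

(** * The convex distance inequality for permutations *)

(** Talagrand's inequality for A with the coordinate [pos s] counted twice.  A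
    choice of weights mu s for every s takes the place of the minimum defining
    the convex distance, so that the induction can build mu without any
    argument of attainment. *)
Definition kernel_bound (R : realType) N (A : {set 'S_N}) (pos : 'S_N -> 'I_N) : Prop :=
  exists mu : 'S_N -> 'S_N -> R, (forall s, prob_on A (mu s)) /\
    \sum_s expR (cost (pos s) (miss (mu s) s) / 32) <= N`!%:R ^+ 2 / #|A|%:R.

Lemma cost_invg (R : realType) N (mu : 'S_N -> R) (s : 'S_N) (v : 'I_N) :
  cost (s^-1%g v) (miss (fun t => mu t^-1%g) s) = cost v (miss mu s^-1%g).
Proof.
rewrite /cost; congr (_ + _); last by rewrite miss_invg permKV.
rewrite [RHS](reindex_inj (@perm_inj _ s)) /=.
by apply: eq_bigr => l _; rewrite miss_invg.
Qed.

(** A chosen value v sits at the position s^-1 v of s, and becomes a chosen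
    position under inversion. *)
Lemma kernel_bound_inv (R : realType) N (A : {set 'S_N}) (v : 'I_N) :
  kernel_bound R [set t | t^-1%g \in A] (fun=> v) ->
  kernel_bound R A (fun s => s^-1%g v).
Proof.
move=> [mu [muP mub]]; exists (fun s t => mu s^-1%g t^-1%g); split=> [s|].
  have [mu0 muA mu1] := muP s^-1%g; split=> // [t tA|].
    by apply: muA; rewrite inE invgK.
  by rewrite -mu1 [RHS](reindex_inj invg_inj).
rewrite (reindex_inj invg_inj) /=.
have -> : #|A| = #|[set t : 'S_N | t^-1%g \in A]|.
  by rewrite -[LHS](card_preimset _ (@invg_inj _)); apply: eq_card => t; rewrite !inE.
apply: le_trans mub; apply: ler_sum => s _; rewrite ler_expR ler_pM2r ?invr_gt0//.
by rewrite cost_invg !invgK.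
Qed.

Section induction_step.
Variables (R : realType) (n : nat).
Hypothesis IH : forall (A : {set 'S_n.+1}) (z : 'I_n.+1), A != finset.set0 ->
  kernel_bound R A (fun=> z).
Variables (A : {set 'S_n.+2}) (z : 'I_n.+2).

Let B (i : 'I_n.+2) : {set 'S_n.+1} := [set r | lift_perm z i r \in A].

(** The contribution of the permutations with value i at z: the mixture of
    weights on the block B i and on a largest block B j.  Blocks of comparable
    size gain by mixing; an empty block is served by B j alone (l = 1). *)
Lemma branch_bound i j : B j != finset.set0 -> (#|B i| <= #|B j|)%N ->
  exists mu : 'S_n.+1 -> 'S_n.+2 -> R, (forall r, prob_on A (mu r)) /\
    \sum_r expR (cost z (miss (mu r) (lift_perm z i r)) / 32) <=
    n.+1`!%:R ^+ 2 / #|B j|%:R * (2 - #|B i|%:R / #|B j|%:R).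
Proof.
move=> Bj0 Bij.
have Bjgt0 : 0 < #|B j|%:R :> R by rewrite ltr0n card_gt0.
have IHv (C : {set 'S_n.+1}) v : C != finset.set0 -> kernel_bound R C (fun s => s^-1%g v).
  move=> C0; apply: kernel_bound_inv; apply: IH.
  have /set0Pn[t tC] := C0; apply/set0Pn; exists t^-1%g.
  by rewrite inE invgK.
have [ij|nij] := eqVneq i j.
  have [mu [muP mub]] := IH ord0 Bj0.
  exists (fun r => push (lift_perm z j) (mu r)); split=> [r|].
    by apply: prob_on_push (muP r) => t; rewrite inE.
  rewrite ij divff ?gt_eqF// addrK mulr1; apply: le_trans mub.
  apply: ler_sum => r _; rewrite ler_expR ler_pM2r ?invr_gt0//.
  rewrite /cost (bigD1_ord z)//= miss_push_lift_id expr0n/= add0r addr0.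
  under eq_bigr do rewrite miss_push_lift.
  by rewrite lerDl sqr_ge0.
set r := #|B i|%:R / #|B j|%:R : R.
have r01 : 0 <= r <= 1.
  by rewrite divr_ge0//= ler_pdivrMr// mul1r ler_nat.
have [l l01 [rl rle]] := interpolation_weight r01.
have [v jE] : exists v : 'I_n.+1, j = lift i v.
  by case: (unliftP i j) nij => [v ->|->]; [exists v|rewrite eqxx].
have [v' iE] : exists v : 'I_n.+1, i = lift j v.
  by case: (unliftP j i) nij => [w ->|->]; [exists w|rewrite eqxx].
have [nu [nuP nub]] := IHv _ v' Bj0.
have [mu muP] : exists mu : 'S_n.+1 -> 'S_n.+1 -> R, l != 1 ->
    (forall s, prob_on (B i) (mu s)) /\
    \sum_(s : 'S_n.+1) expR (cost (s^-1%g v) (miss (mu s) s) / 32) <=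
      n.+1`!%:R ^+ 2 / #|B i|%:R.
  have [Bi0|Bi0] := eqVneq (B i) finset.set0.
    by exists (fun=> fun=> 0); rewrite rl ?eqxx// /r Bi0 cards0 mul0r.
  by have [mu H] := IHv _ v Bi0; exists mu.
have [f [fbij fE]] := lift_perm_tperm z i j.
(* Among the remaining values v stands for j and v' for i, and (i j) s takes
   the value i where s takes the value j: the chosen positions coincide. *)
have fv (s : 'S_n.+1) : (f s)^-1%g v' = s^-1%g v.
  apply: (@perm_inj _ (f s)); rewrite permKV.
  apply: (@lift_inj _ j); rewrite -iE -(lift_perm_lift z j) fE permM.
  by rewrite lift_perm_lift permKV -jE tpermR.
have fne (s : 'S_n.+1) (k : 'I_n.+1) : k != s^-1%g v -> lift j (f s k) = lift i (s k).
  move=> kv; rewrite -(lift_perm_lift z) fE permM lift_perm_lift tpermD//.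
    by rewrite neq_lift.
  rewrite jE (inj_eq lift_inj); apply: contra kv => /eqP ->.
  by rewrite permK.
pose ka (s : 'S_n.+1) (t : 'S_n.+2) :=
  (1 - l) * push (lift_perm z i) (mu s) t + l * push (lift_perm z j) (nu (f s)) t.
have kaP s : prob_on A (ka s).
  apply: prob_on_mix => //.
    by move=> /muP[muP' _]; apply: prob_on_push (muP' s) => t; rewrite inE.
  by apply: prob_on_push (nuP (f s)) => t; rewrite inE.
exists ka; split=> //.
set q := lift_perm z i.
have nuge s k : 0 <= miss (nu s) s k by apply: miss_ge0; case: (nuP s).
have cost_le s : cost z (miss (ka s) (q s)) <=
   (1 - l) * cost (s^-1%g v) (miss (mu s) s) +
   l * cost ((f s)^-1%g v') (miss (nu (f s)) (f s)) + 4 * l ^+ 2.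
  rewrite fv; apply: cost_mix => //.
  - rewrite miss_ge0 /=; last by case: (kaP s).
    rewrite miss_mix miss_push_lift_id mulr0 add0r -[leRHS]mulr1 ler_wpM2l//.
      by case/andP: l01.
    apply: (@miss_le1 _ _ A).
    by apply: prob_on_push (nuP (f s)) => t; rewrite inE.
  - move=> k kv; rewrite miss_mix miss_push_lift; congr (_ + _ * _).
    rewrite -(miss_push_lift z j); apply: eq_bigl => t.
    by rewrite !lift_perm_lift fne.
  - rewrite miss_ge0 /=; last by case: (kaP s).
    rewrite miss_mix miss_push_lift -addrA lerD2l -[X in _ <= _ + X]mulr1 -mulrDr.
    rewrite ler_wpM2l//; first by case/andP: l01.
    apply: (@le_trans _ _ 1); last by rewrite lerDr.
    apply: (@miss_le1 _ _ A).
    by apply: prob_on_push (nuP (f s)) => t; rewrite inE.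
have F0 : 0 < n.+1`!%:R ^+ 2 :> R by rewrite exprn_gt0// ltr0n fact_gt0.
have K2gt0 : 0 < n.+1`!%:R ^+ 2 / #|B j|%:R :> R by rewrite divr_gt0.
have sumf : \sum_s expR (cost ((f s)^-1%g v') (miss (nu (f s)) (f s)) / 32) <=
    n.+1`!%:R ^+ 2 / #|B j|%:R.
  by have := nub; rewrite (reindex f (onW_bij _ fbij)).
set K2 : R := _ / #|B j|%:R in K2gt0 sumf *.
(* When r = 0 the weight l is 1 and the first sum has weight 0; dividing by 1
   instead of r is then harmless because ln 0 = ln 1. *)
pose r' := if r == 0 then 1 else r.
have r'gt0 : 0 < r'.
  by rewrite /r'; case: eqVneq => // rn0; rewrite lt_neqAle eq_sym rn0; case/andP: r01.
have lnr' : ln r' = ln r by rewrite /r'; case: eqVneq => [->|//]; rewrite ln1 ln0.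
have sumg : l != 1 -> \sum_(s : 'S_n.+1) expR (cost (s^-1%g v) (miss (mu s) s) / 32) <= K2 / r'.
  move=> l1; have [_ /le_trans] := muP l1; apply.
  rewrite /r'; case: eqVneq => [/rl/eqP|rn0]; first by rewrite (negbTE l1).
  rewrite /K2 /r invf_div mulrA divfK ?gt_eqF//.
have := log_convex_sum l01 (divr_gt0 K2gt0 r'gt0) K2gt0 sumg sumf.
set S := \sum_s _ => HS.
apply: (@le_trans _ _ (S * expR (l ^+ 2 / 8))).
  rewrite /S mulr_suml; apply: ler_sum => s _; rewrite -expRD ler_expR.
  have := cost_le s; lra.
have KE : expR ((1 - l) * ln (K2 / r') + l * ln K2) = K2 * expR ((1 - l) * - ln r).
  rewrite ln_div ?posrE// lnr' -[in RHS](lnK (x := K2)) ?posrE// -expRD.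
  by congr expR; ring.
apply: (@le_trans _ _ (K2 * expR ((1 - l) * - ln r) * expR (l ^+ 2 / 8))).
  by rewrite ler_wpM2r ?expR_ge0// -KE.
rewrite -mulrA -expRD ler_wpM2l ?(ltW K2gt0)//.
by rewrite -[leRHS]lnK ?ler_expR// posrE; case/andP: r01 => _ ?; lra.
Qed.

Lemma card_lift_perm_blocks : (#|A| = \sum_i #|B i|)%N.
Proof.
rewrite -sum1_card (reindex _ (onW_bij _ (lift_perm_bij z))) /=.
rewrite (eq_bigl (fun p => xpredT p.1 && (p.2 \in B p.1))); last by move=> p; rewrite inE.
rewrite -(pair_big_dep xpredT (fun i r => r \in B i) (fun _ _ => 1%N)) /=.
by apply: eq_bigr => i _; rewrite sum1_card.
Qed.

(** Summing [branch_bound] over i reduces the claim to (2 N - q) q <= N^2, where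
    q = #|A| / #|B j| and N is the number of blocks. *)
Lemma kernel_bound_step : A != finset.set0 -> kernel_bound R A (fun=> z).
Proof.
move=> A0.
have [j _ /= jmax] := @arg_maxnP _ z xpredT (fun i => #|B i|) isT.
have Bj0 : B j != finset.set0.
  rewrite -cards_eq0 -leqn0 -ltnNge lt0n; apply: contra A0 => /eqP Bj0.
  rewrite -cards_eq0 card_lift_perm_blocks sum_nat_eq0; apply/forallP => i.
  by rewrite implyTb -leqn0 -Bj0 jmax.
have H i := branch_bound Bj0 (jmax i isT).
pose mu i := projT1 (cid (H i)).
have muP i r : prob_on A (mu i r) by rewrite /mu; case: cid => ? [].
have mub i : \sum_r expR (cost z (miss (mu i r) (lift_perm z i r)) / 32) <=
    n.+1`!%:R ^+ 2 / #|B j|%:R * (2 - #|B i|%:R / #|B j|%:R).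
  by rewrite /mu; case: cid => ? [].
have [g fK gK] := lift_perm_bij z.
exists (fun s => mu (g s).1 (g s).2); split=> //.
rewrite (reindex _ (onW_bij _ (lift_perm_bij z))) /=.
under eq_bigr => p _ do rewrite (fK p).
rewrite -(pair_big xpredT xpredT (fun i r =>
  expR (cost z (miss (mu i r) (lift_perm z i r)) / 32))) /=.
apply: le_trans (ler_sum _ (fun i _ => mub i)) _.
have Bjgt0 : 0 < #|B j|%:R :> R by rewrite ltr0n card_gt0.
rewrite -mulr_sumr big_split /= sumrN -mulr_suml sumr_const card_ord -natr_sum.
rewrite -card_lift_perm_blocks.
have Agt0 : 0 < #|A|%:R :> R by rewrite ltr0n card_gt0.
rewrite [in X in _ <= X]factS natrM exprMn.
rewrite -(mulr_natl 2) -subr_ge0.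
move: (n.+1)`!%:R n.+2%:R => F N.
set b := #|B j|%:R in Bjgt0 *; set a := #|A|%:R in Agt0 *.
have -> : N ^+ 2 * F ^+ 2 / a - F ^+ 2 / b * (N * 2 - a / b) =
    F ^+ 2 * ((N - a / b) ^+ 2 / a).
  by field; rewrite !gt_eqF.
by rewrite mulr_ge0 ?divr_ge0 ?sqr_ge0// ltW.
Qed.

End induction_step.

(** Talagrand's convex distance inequality for the symmetric group.  The
    induction starts at degree 1, where no two permutations disagree. *)
Theorem perm_kernel_bound (R : realType) n (A : {set 'S_n.+1}) (z : 'I_n.+1) :
  A != finset.set0 -> kernel_bound R A (fun=> z).
Proof.
elim: n A z => [|n IH] A z A0; last exact: kernel_bound_step.
have A1 : A = [set: 'S_1].
  have /set0Pn[s sA] := A0; apply/setP => t; rewrite inE.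
  suff -> : t = s by [].
  by apply/permP => i; rewrite !ord1.
have card1 : #|A| = 1%N by rewrite A1 cardsT card_Sn.
exists (fun _ _ => 1); split=> [s|].
  split=> // [t|]; first by rewrite A1 inE.
  by rewrite sumr_const -cardsT -A1 card1.
have miss0 (s : 'S_1) l : miss (fun=> 1) s l = 0 :> R.
  by rewrite /miss big1// => t; rewrite !ord1 eqxx.
rewrite card1 factS fact0 expr1n divr1.
under eq_bigr => s _.
  rewrite /cost big1 => [|l _]; last by rewrite miss0 expr0n.
  rewrite miss0 expr0n addr0 mul0r expR0.
  over.
by rewrite sumr_const -cardsT -A1 card1.
Qed.

(** * The largest modulus of an eigenvalue as a maximum of the quadratic form *)

Local Open Scope classical_set_scope.

Definition dotp (R : realType) n (u v : 'rV[R]_n) : R := \sum_i u 0 i * v 0 i.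

Definition qform (R : realType) n (A : 'M[R]_n) (v : 'rV[R]_n) : R := dotp (v *m A) v.

Section dotp.
Variables (R : realType) (n : nat).
Implicit Types (u v w : 'rV[R]_n) (A B : 'M[R]_n).

Lemma dotpE u v : dotp u v = (u *m v^T) 0 0.
Proof. by rewrite mxE; apply: eq_bigr => i _; rewrite mxE. Qed.

Lemma dotpC u v : dotp u v = dotp v u.
Proof. by apply: eq_bigr => i _; rewrite mulrC. Qed.

Lemma dotpDl u v w : dotp (u + v) w = dotp u w + dotp v w.
Proof. by rewrite !dotpE mulmxDl mxE. Qed.

Lemma dotpZl a u w : dotp (a *: u) w = a * dotp u w.
Proof. by rewrite !dotpE -scalemxAl mxE. Qed.

Lemma dotpDr u v w : dotp w (u + v) = dotp w u + dotp w v.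
Proof. by rewrite dotpC dotpDl !(dotpC w). Qed.

Lemma dotpZr a u w : dotp w (a *: u) = a * dotp w u.
Proof. by rewrite dotpC dotpZl (dotpC w). Qed.

Lemma dotp_ge0 v : 0 <= dotp v v.
Proof. by apply: sumr_ge0 => i _; rewrite -expr2 sqr_ge0. Qed.

Lemma dotp_eq0 v : (dotp v v == 0) = (v == 0).
Proof.
apply/eqP/eqP => [/eqP|->]; last by apply: big1 => i _; rewrite mxE mul0r.
rewrite psumr_eq0 => [/allP v0|i _]; last by rewrite -expr2 sqr_ge0.
apply/rowP => i; have := v0 i (mem_index_enum i).
by rewrite mulf_eq0 orbb mxE => /eqP.
Qed.

Lemma qformE A v : qform A v = \sum_i \sum_j v 0 i * A i j * v 0 j.
Proof.
rewrite /qform /dotp exchange_big /=; apply: eq_bigr => j _.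
by rewrite mxE mulr_suml.
Qed.

Lemma qformZ A a v : qform A (a *: v) = a ^+ 2 * qform A v.
Proof. by rewrite /qform -scalemxAl dotpZl dotpZr mulrA. Qed.

Lemma sym_dotp A u v : A^T = A -> dotp (u *m A) v = dotp u (v *m A).
Proof. by move=> As; rewrite !dotpE trmx_mul As mulmxA. Qed.

Lemma continuous_qform A : continuous (qform A).
Proof.
rewrite (_ : qform A = fun v => \sum_i \sum_j v 0 i * A i j * v 0 j); last first.
  by apply/funext => v; rewrite qformE.
apply: continuous_big => [|i _]; first exact: add_continuous.
apply: continuous_big => [|j _ v]; first exact: add_continuous.
apply: (@continuousM R 'rV[R]_n); last exact: coord_continuous.
by apply: (@continuousM R 'rV[R]_n); [exact: coord_continuous | exact: cst_continuous].
Qed.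

Lemma continuous_dotp : continuous (fun v : 'rV[R]_n => dotp v v).
Proof.
apply: continuous_big => [|i _ v]; first exact: add_continuous.
by apply: (@continuousM R 'rV[R]_n); exact: coord_continuous.
Qed.

Lemma compact_sphere : compact [set v : 'rV[R]_n | dotp v v = 1].
Proof.
have := @rV_compact R n (fun=> `[-1, 1]%classic) (fun=> @segment_compact R (-1) 1).
move=> /subclosed_compact; apply.
  rewrite (_ : [set v | _] = (fun v : 'rV[R]_n => dotp v v) @^-1` [set 1])//.
  by apply: preimage_closed; [move=> v _; exact: continuous_dotp | exact: closed_eq].
move=> v /= v1 i; rewrite /= in_itv /= -ler_norml -sqrtr_sqr -sqrtr1 ler_wsqrtr//.
rewrite -v1 /dotp (bigD1 i)//= -expr2 lerDl sumr_ge0// => j _.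
by rewrite -expr2 sqr_ge0.
Qed.

End dotp.

Section rayleigh.
Variables (R : realType) (n : nat).

(** With e the sign of the form at the maximiser v, the form
    |q(v)| |u|^2 - e q(u) is nonnegative and vanishes at v, so v lies in its
    kernel. *)
Lemma qform_max_eigenvector (A : 'M[R]_n) (v : 'rV[R]_n) : A^T = A ->
  dotp v v = 1 -> (forall u, `|qform A u| <= `|qform A v| * dotp u u) ->
  v *m A = qform A v *: v.
Proof.
move=> As v1 vmax.
set a := qform A v.
pose e : R := if 0 <= a then 1 else -1.
have ea : e * a = `|a|.
  rewrite /e; case: ifPn => [/ger0_norm->|]; first by rewrite mul1r.
  by rewrite -ltNge => /ltr0_norm->; rewrite mulN1r.
have ee : e * e = 1 by rewrite /e; case: ifP; rewrite ?mulr1// mulrNN mulr1.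
have Pge0 u : 0 <= `|a| * dotp u u - e * qform A u.
  rewrite subr_ge0; apply: le_trans (vmax u); apply: le_trans (ler_norm _) _.
  by rewrite normrM /e; case: ifP; rewrite ?normrN normr1 mul1r.
(* x is the gradient of this form at v; moving from v in the direction t x
   changes the form by 2 t |x|^2 + O(t^2), which forces x = 0. *)
have [x xE] : exists x, x = `|a| *: v - e *: (v *m A) by eexists.
have x0 : dotp x x = 0.
  pose b := dotp x x; pose c := `|a| * dotp x x - e * qform A x.
  have bE : b = `|a| * dotp v x - e * dotp (v *m A) x.
    by rewrite /b {1}xE dotpDl -scaleNr !dotpZl mulNr.
  have Pt t : 0 <= 2 * t * b + t ^+ 2 * c.
    have := Pge0 (v + t *: x).
    have -> : dotp (v + t *: x) (v + t *: x) = 1 + 2 * t * dotp v x + t ^+ 2 * dotp x x.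
      by rewrite !(dotpDl, dotpDr, dotpZl, dotpZr) v1 (dotpC x v); ring.
    have -> : qform A (v + t *: x) =
        a + 2 * t * dotp (v *m A) x + t ^+ 2 * qform A x.
      rewrite /a /qform mulmxDl -scalemxAl !(dotpDl, dotpDr, dotpZl, dotpZr).
      by rewrite (sym_dotp x v As) (dotpC x (v *m A)); ring.
    move=> /le_trans; apply; rewrite le_eqVlt; apply/orP; left; apply/eqP.
    by rewrite bE /c -ea; ring.
  have b0 : 0 <= b by exact: dotp_ge0.
  have c0 : 0 <= c by exact: Pge0.
  apply/eqP; rewrite eq_le b0 andbT leNgt; apply/negP => bgt0.
  have := Pt (- b / (c + 1)).
  have -> : 2 * (- b / (c + 1)) * b + (- b / (c + 1)) ^+ 2 * c =
     - (b ^+ 2 * (c + 2) / (c + 1) ^+ 2) by field; rewrite gt_eqF// ltr_wpDl.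
  by rewrite oppr_ge0 leNgt divr_gt0 ?mulr_gt0 ?exprn_gt0// ltr_wpDl.
move/eqP: x0; rewrite dotp_eq0 xE subr_eq0 => /eqP /(congr1 ( *:%R e)).
by rewrite !scalerA ee scale1r -ea mulrA ee mul1r.
Qed.

(** A maximiser of |q| on the compact unit sphere is an eigenvector, and no
    eigenvalue has a larger modulus. *)
Lemma lambda_max_qform (A : 'M[R]_n) : (0 < n)%N -> A^T = A ->
  (exists2 v, dotp v v = 1 & `|qform A v| = lambda_max A) /\
  forall v, `|qform A v| <= lambda_max A * dotp v v.
Proof.
move=> n0 As.
have [v1] : exists2 c, c \in [set v : 'rV[R]_n | dotp v v = 1] &
    forall t, t \in [set v : 'rV[R]_n | dotp v v = 1] -> `|qform A t| <= `|qform A c|.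
  apply: compact_EVT_max; last 2 first.
  - exact: compact_sphere.
  - apply: continuous_subspaceT => v.
    by apply: continuous_comp; [exact: continuous_qform | exact: norm_continuous].
  exists (delta_mx 0 (Ordinal n0)) => /=.
  rewrite /dotp (bigD1 (Ordinal n0))//= big1 => [|i /negbTE i0].
    by rewrite !mxE !eqxx mulr1 addr0.
  by rewrite !mxE i0 andbF mul0r.
rewrite inE /= => v11 H.
have {}H u : `|qform A u| <= `|qform A v1| * dotp u u.
  have [->|u0] := eqVneq u 0.
    have /eqP d0 : dotp (0 : 'rV[R]_n) 0 == 0 by rewrite dotp_eq0.
    by rewrite /qform mul0mx d0 normr0 mulr0.
  have ugt0 : 0 < dotp u u by rewrite lt_neqAle eq_sym dotp_eq0 u0 dotp_ge0.
  have := H ((Num.sqrt (dotp u u))^-1 *: u).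
  rewrite inE /= dotpZl dotpZr qformZ mulrA -expr2 exprVn sqr_sqrtr ?dotp_ge0//.
  rewrite mulVf ?gt_eqF// => /(_ erefl).
  by rewrite normrM ger0_norm ?invr_ge0 ?dotp_ge0// ler_pdivrMl// mulrC.
have ev := qform_max_eigenvector As v11 H.
suff <- : `|qform A v1| = lambda_max A by split=> //; exists v1.
pose E := [set `|a| | a in [set a : R | eigenvalue A a]].
have Ev : E `|qform A v1|.
  exists (qform A v1) => //=; apply/eigenvalueP; exists v1 => //.
  by rewrite -dotp_eq0 v11 oner_eq0.
have ubE : ubound E `|qform A v1|.
  move=> _ [a /= /eigenvalueP[u ua u0] <-].
  have ugt0 : 0 < dotp u u by rewrite lt_neqAle eq_sym dotp_eq0 u0 dotp_ge0.
  have := H u; rewrite {1}/qform ua dotpZl normrM (ger0_norm (dotp_ge0 u)).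
  by rewrite ler_pM2r.
apply/eqP; rewrite eq_le /lambda_max -/E; apply/andP; split.
  by apply: ub_le_sup => //; exists `|qform A v1|.
by apply: ge_sup => //; exists `|qform A v1|.
Qed.

End rayleigh.

(** * Concentration on the symmetric group *)

Section concentration.
Variable R : realType.

(** Markov's inequality applied to the exponential bound. *)
Lemma perm_talagrand N (A B : {set 'S_N}) (D : R) : (0 < N)%N ->
  (forall s mu, s \in B -> prob_on A mu -> D <= \sum_l miss mu s l ^+ 2) ->
  #|A|%:R * #|B|%:R <= N`!%:R ^+ 2 * expR (- (D / 32)) :> R.
Proof.
case: N A B => // N A B _ HD.
have [->|A0] := eqVneq A finset.set0.
  by rewrite cards0 mul0r mulr_ge0 ?expR_ge0// sqr_ge0.
have [mu [muP mub]] := perm_kernel_bound R ord0 A0.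
have Agt0 : 0 < #|A|%:R :> R by rewrite ltr0n card_gt0.
have : #|B|%:R * expR (D / 32) <= N.+1`!%:R ^+ 2 / #|A|%:R.
  apply: le_trans mub; rewrite mulr_natl -sumr_const big_mkcond /=.
  apply: ler_sum => s _; case: ifPn => [sB|_]; last exact: expR_ge0.
  rewrite ler_expR ler_pM2r ?invr_gt0// (le_trans (HD _ _ sB (muP s)))//.
  by rewrite lerDl sqr_ge0.
by rewrite ler_pdivlMr// expRN ler_pdivlMr ?expR_gt0// mulrC mulrA.
Qed.

Lemma qform_sum (T : finType) n (mu : T -> R) (M : T -> 'M[R]_n) v :
  qform (\sum_t mu t *: M t) v = \sum_t mu t * qform (M t) v.
Proof.
rewrite /qform dotpE mulmx_sumr mulmx_suml summxE; apply: eq_bigr => t _.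
by rewrite -scalemxAr -scalemxAl mxE -dotpE.
Qed.

Lemma qformB n (A B : 'M[R]_n) v : qform (A - B) v = qform A v - qform B v.
Proof. by rewrite /qform !dotpE mulmxBr mulmxBl mxE [X in _ + X]mxE. Qed.

(** Cauchy-Schwarz against the rank-one matrix v^T v of norm 1. *)
Lemma qform_frobenius n (A : 'M[R]_n) v : dotp v v = 1 ->
  qform A v ^+ 2 <= \sum_i \sum_j A i j ^+ 2.
Proof.
move=> v1.
have E q : \sum_i \sum_j (A i j - q * (v 0 i * v 0 j)) ^+ 2 =
    \sum_i \sum_j A i j ^+ 2 - 2 * q * qform A v + q ^+ 2 * (dotp v v * dotp v v).
  rewrite qformE /dotp [X in _ + _ * X]mulr_suml !mulr_sumr -sumrN -!big_split /=.
  apply: eq_bigr => i _; rewrite !mulr_sumr -sumrN -!big_split /=.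
  by apply: eq_bigr => j _; ring.
have : 0 <= \sum_i \sum_j (A i j - qform A v * (v 0 i * v 0 j)) ^+ 2.
  by apply: sumr_ge0 => i _; apply: sumr_ge0 => j _; rewrite sqr_ge0.
by rewrite E v1; lra.
Qed.

(** The set lambda_max <= u is convex, hence contains every mixture of the
    M t, and lambda_max is 1-Lipschitz for the Frobenius norm. *)
Lemma lambda_max_separation (T : finType) n (A : {set T}) (mu : T -> R)
    (M : T -> 'M[R]_n) (M0 : 'M[R]_n) (u d : R) : (0 < n)%N ->
  prob_on A mu -> (forall t, (M t)^T = M t) -> M0^T = M0 -> 0 <= d ->
  (forall t, t \in A -> lambda_max (M t) <= u) -> u + d <= lambda_max M0 ->
  d ^+ 2 <= \sum_i \sum_j (\sum_t mu t * (M0 i j - M t i j)) ^+ 2.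
Proof.
move=> n0 [mu0 muA mu1] Ms M0s d0 Au ud.
have [[v v1 vM0] _] := lambda_max_qform n0 M0s.
pose K := \sum_t mu t *: M t.
have qK : `|qform K v| <= u.
  rewrite qform_sum -[leRHS]mul1r -mu1 mulr_suml.
  apply: le_trans (ler_norm_sum _ _ _) _; apply: ler_sum => t _.
  rewrite normrM (ger0_norm (mu0 t)).
  have [tA|/muA->] := boolP (t \in A); last by rewrite !mul0r.
  have [_ /(_ v)] := lambda_max_qform n0 (Ms t); rewrite v1 mulr1 => H.
  by rewrite ler_wpM2l// (le_trans H)// Au.
have -> : \sum_i \sum_j (\sum_t mu t * (M0 i j - M t i j)) ^+ 2 =
    \sum_i \sum_j (M0 - K) i j ^+ 2.
  apply: eq_bigr => i _; apply: eq_bigr => j _; congr (_ ^+ 2).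
  under eq_bigr do rewrite mulrBr.
  rewrite big_split /= sumrN -mulr_suml mu1 mul1r !mxE summxE.
  by congr (_ - _); apply: eq_bigr => t _; rewrite mxE.
apply: le_trans (qform_frobenius _ v1); rewrite qformB -[leRHS]real_normK ?num_real//.
rewrite lerXn2r ?nnegrE//.
have := lerB_dist (qform M0 v) (qform K v); rewrite vM0; lra.
Qed.

End concentration.

(** * Symmetric matrices filled with a permuted vector *)

Section symmetric_from_entries.
Variable n : nat.
Local Notation N := ((n * (n + 1)) %/ 2)%N.

Lemma upper_pos_subproof (i j : 'I_n) :
  exists k, (if (i <= j)%N then (i, j) else (j, i)) = tnth (upper_index n) k.
Proof.
apply/tnthP; rewrite mem_enum inE; case: ifPn => //=.
by rewrite -ltnNge => /ltnW.
Qed.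

Definition upper_pos (i j : 'I_n) : 'I_N := sval (cid (upper_pos_subproof i j)).

Lemma tnth_upper_pos i j :
  tnth (upper_index n) (upper_pos i j) = if (i <= j)%N then (i, j) else (j, i).
Proof. by rewrite /upper_pos; case: cid. Qed.

Lemma upper_posC i j : upper_pos i j = upper_pos j i.
Proof.
have U : uniq (upper_index n) by exact: enum_uniq.
apply: (tuple_uniqP _ U); rewrite !tnth_upper_pos.
by case: ltngtP => // /val_inj ->.
Qed.

(** Only (i, j) and (j, i) share a position of the vector of entries. *)
Lemma sum_upper_pos (R : realType) (g : 'I_N -> R) : (forall k, 0 <= g k) ->
  \sum_i \sum_j g (upper_pos i j) <= 2 * \sum_k g k.
Proof.
move=> g0; rewrite pair_big /= (partition_big (fun p => upper_pos p.1 p.2) xpredT)//=.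
rewrite mulr_sumr; apply: ler_sum => k _.
rewrite (eq_bigr (fun=> g k)); last by move=> p /eqP ->.
rewrite sumr_const mulr_natl ler_wpMn2l//.
set p := tnth (upper_index n) k.
apply: (@leq_trans #|[set p; (p.2, p.1)]%SET|); last by rewrite cards2; case: eqP.
apply: subset_leq_card; apply/fintype.subsetP => -[i j].
move=> /eqP/val_inj/= ijk; rewrite !inE.
have := tnth_upper_pos i j; rewrite ijk -/p; by case: ifP => _ ->; rewrite /= eqxx ?orbT.
Qed.

Definition sym_mx (R : realType) (w : N.-tuple R) : 'M[R]_n :=
  \matrix_(i, j) tnth w (upper_pos i j).

Lemma sym_mxT (R : realType) (w : N.-tuple R) : (sym_mx w)^T = sym_mx w.
Proof. by apply/matrixP => i j; rewrite !mxE upper_posC. Qed.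

Lemma upper_entriesK (R : realType) (A : 'M[R]_n) : A^T = A -> sym_mx (upper_entries A) = A.
Proof.
move=> As; apply/matrixP => i j; rewrite mxE tnth_map tnth_upper_pos.
by case: ifP => //= _; rewrite -[in LHS]As mxE.
Qed.

End symmetric_from_entries.

Definition perm_tuple (T : Type) N (a : N.-tuple T) (s : 'S_N) : N.-tuple T :=
  [tuple tnth a (s i) | i < N].

Lemma ler_norm_spread (R : realType) L (x : L.-tuple R) (y z : R) :
  sorted <%R x -> y \in x -> z \in x -> `|y - z| <= spread x.
Proof.
case: x => -[|x0 x]//= xL xs.
have bounds y' : y' \in x0 :: x -> x0 <= y' <= last x0 x.
  move=> yx.
  have {}xs : sorted <=%R (x0 :: x) by apply: sub_path xs => ? ? /ltW.
  have ix : (index y' (x0 :: x) < (size x).+1)%N by rewrite index_mem.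
  have le_nth := sorted_leq_nth (@le_trans _ R) (@lexx _ R) x0 xs.
  rewrite -(nth_index x0 yx) (last_nth x0); apply/andP; split.
    by apply: (le_nth 0%N); rewrite ?inE.
  by apply: le_nth; rewrite ?inE//= -ltnS.
move=> /bounds/andP[y0 y1] /bounds/andP[z0 z1].
rewrite /spread /= ler_norml; lra.
Qed.

Section convex_distance_lambda_max.
Variables (R : realType) (n L : nat) (x : L.-tuple R).
Local Notation N := ((n * (n + 1)) %/ 2)%N.
Variable a : N.-tuple R.
Hypotheses (n0 : (0 < n)%N) (xs : sorted <%R x) (ax : all (mem x) a).
Hypothesis spread0 : 0 < spread x.

Let Z (s : 'S_N) := lambda_max (sym_mx (perm_tuple a s)).

(** The product form P(Z <= u) P(Z >= u + d) <= exp(- d^2 / (64 spread^2)); it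
    yields both tails, depending on which of the two events is bounded below
    by the median property. *)
Lemma perm_lambda_max_tail (u d : R) : 0 <= d ->
  #|[set s | Z s <= u]%SET|%:R * #|[set s | u + d <= Z s]%SET|%:R <=
  N`!%:R ^+ 2 * expR (- (d ^+ 2 / (64 * spread x ^+ 2))) :> R.
Proof.
move=> d0.
have N0 : (0 < N)%N by case: n n0 => // m _; rewrite divn_gt0// addn1; lia.
apply: le_trans (perm_talagrand (D := d ^+ 2 / (2 * spread x ^+ 2)) N0 _) _ => [s mu|].
  rewrite inE => sB muA; have [mu0 _ _] := muA.
  have Ad t : t \in [set s | Z s <= u]%SET -> lambda_max (sym_mx (perm_tuple a t)) <= u.
    by rewrite inE.
  have := lambda_max_separation n0 muA (fun t => sym_mxT _) (sym_mxT _) d0 Ad sB.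
  move=> /le_trans H; rewrite ler_pdivrMr ?mulr_gt0 ?exprn_gt0//; apply: H.
  pose g k := (spread x * miss mu s k) ^+ 2.
  apply: (@le_trans _ _ (\sum_(i < n) \sum_(j < n) g (upper_pos i j))).
    apply: ler_sum => i _; apply: ler_sum => j _; rewrite -[leLHS]real_normK ?num_real//.
    rewrite lerXn2r ?nnegrE//; first by rewrite mulr_ge0 ?miss_ge0// ltW.
    apply: le_trans (ler_norm_sum _ _ _) _.
    rewrite /miss mulr_sumr [leRHS]big_mkcond /=; apply: ler_sum => t _.
    rewrite !mxE !tnth_mktuple normrM (ger0_norm (mu0 _)).
    case: eqVneq => [->|_]; first by rewrite subrr normr0 mulr0.
    rewrite mulrC ler_wpM2r// (ler_norm_spread xs)//.
      by apply: (allP ax); exact: mem_tnth.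
    by apply: (allP ax); exact: mem_tnth.
  apply: le_trans (sum_upper_pos _) _ => [k|]; first exact: sqr_ge0.
  rewrite /g; under eq_bigr do rewrite exprMn.
  by rewrite -mulr_sumr [leRHS]mulrC mulrA.
suff -> : d ^+ 2 / (2 * spread x ^+ 2) / 32 = d ^+ 2 / (64 * spread x ^+ 2) by [].
by field; rewrite gt_eqF.
Qed.

End convex_distance_lambda_max.

(** * The uniform law on the multislice as a law of permuted vectors *)

Section uniform_multislice.
Variables (R : realType) (L N : nat) (kappa : L.-tuple nat) (x : L.-tuple R).
Local Notation Omega := (multislice (N := N) kappa x).

Lemma multislice_perm_eq (a w : N.-tuple R) : Omega a -> Omega w -> perm_eq w a.
Proof.
move=> [xa ka] [xw kw]; apply/allP => y; rewrite mem_cat => yaw.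
have /tnthP[l ->] : y \in x by case/orP: yaw => [/(allP xw)|/(allP xa)].
by rewrite /= kw ka.
Qed.

Lemma perm_tuple_eq (a : N.-tuple R) (s : 'S_N) : perm_eq (perm_tuple a s) a.
Proof. by apply/tuple_permP; exists s. Qed.

Lemma multislice_perm_tuple (a : N.-tuple R) (s : 'S_N) :
  Omega a -> Omega (perm_tuple a s).
Proof.
move=> [xa ka]; have e := perm_tuple_eq a s; split=> [|l].
  by rewrite (perm_all _ e).
by rewrite (seq.permP e).
Qed.

(** Left translation by r identifies the fibres, so a uniform permutation
    induces the uniform law on the orbit of a. *)
Lemma card_perm_tuple_fiber (a : N.-tuple R) (r : 'S_N) :
  #|[set s | perm_tuple a s == perm_tuple a r]%SET| =
  #|[set s : 'S_N | perm_tuple a s == a]%SET|.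
Proof.
rewrite -(card_preimset _ (mulgI r)).
apply: eq_card => s; rewrite !inE; apply/eqP/eqP => [H|H].
  apply: eq_from_tnth => i; have := congr1 (fun t => tnth t (r^-1%g i)) H.
  by rewrite !tnth_mktuple permM permKV.
apply: eq_from_tnth => i; rewrite !tnth_mktuple permM.
by rewrite -[in RHS]H tnth_mktuple.
Qed.

Lemma multislice_probE (a : N.-tuple R) (B : set (N.-tuple R)) : Omega a ->
  multislice_prob kappa x B =
  (#|[set s | `[< B (perm_tuple a s) >]]%SET|%:R / N`!%:R)%:E.
Proof.
move=> Oa; set c := #|[set s : 'S_N | perm_tuple a s == a]%SET|.
have finO C : finite_set (C `&` Omega).
  by apply: sub_finite_set (@finite_multislice _ _ _ kappa x); exact: subIsetr.
have count C : #|[set s | `[< C (perm_tuple a s) >]]%SET| =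
    (#|` fset_set (C `&` Omega)| * c)%N.
  rewrite -sum1_card (eq_bigl (fun s => perm_tuple a s \in fset_set (C `&` Omega))); last first.
    move=> s; rewrite inE in_fset_set//; apply/asboolP/idP => [Cs|]; last by rewrite inE => -[].
    by rewrite inE; split=> //; exact: multislice_perm_tuple.
  rewrite big_mkcond (eq_bigr (fun s =>
    \sum_(w <- fset_set (C `&` Omega)) (perm_tuple a s == w)))%N; last first.
    move=> s _; transitivity (perm_tuple a s \in fset_set (C `&` Omega) : nat).
      by case: (_ \in _).
    rewrite -(count_uniq_mem _ (fset_uniq _)) -sum1_count big_mkcond /=.
    by apply: eq_bigr => w _; rewrite eq_sym; case: eqP.
  rewrite exchange_big /= big_seq (eq_bigr (fun=> c)).
    by rewrite -big_seq big_const_seq count_predT iter_addn_0 mulnC.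
  move=> w; rewrite in_fset_set// inE => -[_ Ow].
  have /tuple_permP[r wE] := multislice_perm_eq Oa Ow.
  have -> : w = perm_tuple a r by exact: val_inj.
  rewrite /c -(card_perm_tuple_fiber a r) -sum1_card [RHS]big_mkcond /=.
  by apply: eq_bigr => s _; rewrite inE; case: eqP.
have := count setT; rewrite setTI.
have -> : #|[set s | `[< @classical_sets.setT (N.-tuple R) (perm_tuple a s) >]]%SET| = N`!.
  by rewrite -[RHS]card_Sn; apply: eq_card => s; rewrite !inE; apply/asboolP.
move=> E; rewrite /multislice_prob count E; congr (_%:E).
have := fact_gt0 N; rewrite E muln_gt0 => /andP[cardO c_gt0].
by rewrite !natrM -mulf_div divff ?mulr1// pnatr_eq0 -lt0n.
Qed.

End uniform_multislice.

(** * Measurability and the law of the entries *)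

Section measurability.
Variables (R : realType) (n : nat) (d : measure_display) (T : measurableType d).
Variable X : T -> 'M[R]_n.
Hypotheses (n0 : (0 < n)%N) (Xs : forall w, (X w)^T = X w)
  (Xm : forall i j, measurable_fun setT (fun w => X w i j)).

(** By continuity of the quadratic form, rational vectors suffice in the
    variational description; lambda_max is therefore a countable supremum of
    measurable functions. *)
Lemma lt_lambda_max_ratP (A : 'M[R]_n) (c : R) : A^T = A ->
  c < lambda_max A <->
  exists q : 'rV[rat]_n, c * dotp (map_mx ratr q) (map_mx ratr q) <
    `|qform A (map_mx ratr q)|.
Proof.
move=> As; have [[v v1 vA] H] := lambda_max_qform n0 As; split; last first.
  move=> [q]; set u := map_mx _ q => /lt_le_trans/(_ (H u)).
  by apply: contraTT; rewrite -!leNgt => H'; rewrite ler_wpM2r// dotp_ge0.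
move=> cA.
pose h (u : 'rV[R]_n) : R := `|qform A u| - c * dotp u u.
have hc : continuous h.
  move=> u; apply: (@continuousB R R^o _ (fun u => `|qform A u|) (fun u => c * dotp u u)).
    by apply: continuous_comp; [exact: continuous_qform | exact: norm_continuous].
  by apply: (@continuousM R 'rV[R]_n (fun=> c)); [exact: cst_continuous | exact: continuous_dotp].
have /hc /= : nbhs (h v) [set y | 0 < y].
  by apply: open_nbhs_nbhs; split; [exact: open_gt | rewrite /h /= vA v1 mulr1 subr_gt0].
move=> /nbhs_ballP[e /= e0 he].
have rat_near i : exists p : rat, `|v 0 i - ratr p| < e.
  have [p] := @rat_in_itvoo R (v 0 i - e) (v 0 i + e) ltac:(lra).
  by rewrite in_itv /= => /andP[p1 p2]; exists p; rewrite ltr_norml; lra.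
exists (\row_i sval (cid (rat_near i))).
rewrite -subr_gt0; apply: he; split=> // i j; rewrite ord1 !mxE.
by case: cid.
Qed.

Lemma measurable_lambda_max : measurable_fun setT (fun w => lambda_max (X w)).
Proof.
apply: (measurability _ (measurable_realfun.RGenOInfty.measurableE R)).
move=> _ [_ [c ->] <-]; rewrite setTI.
rewrite [X in measurable X](_ : _ = \bigcup_(q in [set: 'rV[rat]_n])
  [set w | c * dotp (map_mx ratr q) (map_mx ratr q) < `|qform (X w) (map_mx ratr q)|]); last first.
  apply/seteqP; split=> w /=.
    by rewrite in_itv/= andbT => /(lt_lambda_max_ratP _ (Xs w))[q Hq]; exists q.
  by move=> [q _ Hq]; rewrite in_itv/= andbT; apply/(lt_lambda_max_ratP _ (Xs w)); exists q.
apply: countable_bigcupT_measurable => [|q]; first exact: countableP.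
rewrite -[X in measurable X]setTI.
apply: (@measurable_realfun.measurable_fun_ltr _ _ R setT
  (fun=> c * dotp (map_mx ratr q) (map_mx ratr q))
  (fun w => `|qform (X w) (map_mx ratr q)|)) => //.
apply: measurableT_comp; first exact: measurable_realfun.normr_measurable.
rewrite (_ : (fun w => _) = fun w =>
  \sum_i \sum_j map_mx ratr q 0 i * X w i j * map_mx ratr q 0 j); last first.
  by apply/funext => w; rewrite qformE.
apply: measurable_sum => i; apply: measurable_sum => j.
apply: measurable_realfun.measurable_funM => //; exact: measurable_realfun.measurable_funM.
Qed.

End measurability.

Lemma measurable_tuple_finite (R : realType) N (F : set (N.-tuple R)) :
  finite_set F -> measurable F.
Proof.
move=> finF; have -> : F = \bigcup_(v in F) [set v].
  by apply/seteqP; split=> [v Fv|v [w Fw ->//]]; exists v.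
apply: fin_bigcup_measurable => // v _.
rewrite (_ : [set v] = \bigcap_i ((fun w : N.-tuple R => tnth w i) @^-1` [set tnth v i])).
  apply: fin_bigcap_measurable => // i _; rewrite -[X in measurable X]setTI.
  by apply: measurable_tnth.
by apply/seteqP; split=> [w -> i _//|w H]; apply: eq_from_tnth => i; exact: H.
Qed.

Section multislice_law.
Variables (R : realType) (L N : nat) (kappa : L.-tuple nat) (x : L.-tuple R).
Variables (d : measure_display) (T : measurableType d) (P : probability T R).
Variables (V : T -> N.-tuple R) (a : N.-tuple R).
Hypotheses (Vm : measurable_fun setT V) (Oa : multislice kappa x a)
  (VP : forall A, measurable A -> pushforward P V A = multislice_prob kappa x A).

(** The law is tested on the finite sets of values in the multislice and on the
    complement of the multislice, which is null: B itself may be far from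
    measurable. *)
Lemma multislice_law_le (E : set T) (B : set (N.-tuple R)) :
  measurable E -> (forall w, E w -> B (V w)) ->
  (P E <= (#|[set s | `[< B (perm_tuple a s) >]]%SET|%:R / N`!%:R)%:E)%E.
Proof.
move=> mE EB; pose Omega := multislice (N := N) kappa x.
have mO : measurable Omega by apply: measurable_tuple_finite; exact: finite_multislice.
have mBO : measurable (B `&` Omega).
  apply: measurable_tuple_finite; apply: sub_finite_set (@finite_multislice _ _ _ kappa x).
  exact: subIsetr.
have mV C : measurable C -> measurable (V @^-1` C).
  by move=> mC; rewrite -[X in measurable X]setTI; exact: Vm.
apply: (@le_trans _ _ (P (V @^-1` (B `&` Omega)) + P (V @^-1` (~` Omega)))%E).
  apply: le_trans (measureU2 _ _ _); [|exact: mV|by apply: mV; exact: measurableC].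
  apply: le_measure; rewrite ?inE//.
    by apply: measurableU; apply: mV => //; exact: measurableC.
  move=> w Ew; have [Ow|Ow] := pselect (Omega (V w)); [left|right] => //.
  by split=> //; exact: EB.
have := VP mBO; rewrite /pushforward => ->.
have := VP (measurableC mO); rewrite /pushforward => ->.
rewrite -(multislice_probE B Oa) (multislice_probE (~` Omega) Oa).
rewrite (_ : #|_| = 0%N); last first.
  apply: eq_card0 => s; rewrite !inE; apply/negbTE/asboolP; apply.
  exact: multislice_perm_tuple.
by rewrite mul0r adde0 /multislice_prob -setIA setIid.
Qed.

End multislice_law.

(** * Concentration of the largest modulus of an eigenvalue *)

Unset Implicit Arguments.
Local Open Scope ring_scope.

Theorem corollary1p9 (R : realType) (n L : nat)
    (kappa : L.-tuple nat) (x : L.-tuple R)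
    (d : measure_display) (T : measurableType d) (P : probability T R)
    (X : T -> 'M[R]_n) :
  (2 <= L)%N ->
  (forall l : 'I_L, (0 < tnth kappa l)%N) ->
  sumn kappa = ((n * (n + 1)) %/ 2)%N ->
  sorted <%R x ->
  (forall w : T, (X w)^T = X w) ->
  (forall i j : 'I_n, measurable_fun setT (fun w => X w i j)) ->
  (forall A : set (((n * (n + 1)) %/ 2).-tuple R), measurable A ->
     pushforward P (fun w => upper_entries (X w)) A = multislice_prob kappa x A) ->
  forall (m t : R),
  is_median P (fun w => lambda_max (X w)) m ->
  0 <= t ->
  (P [set w | (t <= `|lambda_max (X w) - m|)%R] <=
     (4 * expR (- (t ^+ 2 / (144 * spread x ^+ 2))))%:E)%E.
Proof.
move=> L2 kappa0 sumk xs Xs Xm law m t [medl medr] t0.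
have n0 : (0 < n)%N.
  rewrite lt0n; apply/eqP => n0; have : (0 < sumn kappa)%N; last by rewrite sumk n0.
  by rewrite sumnE big_tuple (bigD1 (Ordinal (ltnW L2)))//= ltn_addr.
have ux : uniq x by exact: lt_sorted_uniq.
have spread0 : 0 < spread x.
  have /lt_le_trans := ler_norm_spread xs (mem_tnth (Ordinal (ltnW L2)) x)
    (mem_tnth (Ordinal L2) x).
  by apply; rewrite normr_gt0 subr_eq0; apply/negP => /eqP/(tuple_uniqP _ ux).
have [a Oa] := multislice_neq0 ux sumk.
have ax : all (mem x) a by case: Oa.
pose N := ((n * (n + 1)) %/ 2)%N.
pose V w := upper_entries (X w).
have Vm : measurable_fun setT V.
  apply/measurable_fun_tnthP => i.
  rewrite (_ : _ \o _ = fun w => X w (tnth (upper_index n) i).1 (tnth (upper_index n) i).2)//.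
  by apply/funext => w; rewrite /= tnth_map.
pose Z w := lambda_max (X w).
pose F (s : 'S_N) := lambda_max (sym_mx (perm_tuple a s)).
have Zm : measurable_fun setT Z by exact: measurable_lambda_max.
have Zle (u : R) : measurable [set w | Z w <= u].
  by rewrite -[X in measurable X]setTI; apply: measurable_realfun.measurable_fun_ler.
have Zge (u : R) : measurable [set w | u <= Z w].
  by rewrite -[X in measurable X]setTI; apply: measurable_realfun.measurable_fun_ler.
have ZV w : Z w = lambda_max (sym_mx (V w)) by rewrite /V upper_entriesK.
have Ple u : (P [set w | (Z w <= u)%R] <= (#|[set s | F s <= u]%SET|%:R / N`!%:R)%:E)%E.
  have := multislice_law_le Vm Oa law (Zle u) (B := fun v => lambda_max (sym_mx v) <= u).
  move=> /(_ _)/le_trans; apply => [w|]; first by rewrite -ZV.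
  rewrite lee_fin ler_pM2r ?invr_gt0 ?ltr0n ?fact_gt0// ler_nat.
  by apply: subset_leq_card; apply/fintype.subsetP => s; rewrite !inE.
have Pge u : (P [set w | (u <= Z w)%R] <= (#|[set s | u <= F s]%SET|%:R / N`!%:R)%:E)%E.
  have := multislice_law_le Vm Oa law (Zge u) (B := fun v => u <= lambda_max (sym_mx v)).
  move=> /(_ _)/le_trans; apply => [w|]; first by rewrite -ZV.
  rewrite lee_fin ler_pM2r ?invr_gt0 ?ltr0n ?fact_gt0// ler_nat.
  by apply: subset_leq_card; apply/fintype.subsetP => s; rewrite !inE.
have le_e : expR (- (t ^+ 2 / (64 * spread x ^+ 2))) <=
    expR (- (t ^+ 2 / (144 * spread x ^+ 2))).
  rewrite ler_expR lerN2 ler_wpM2l ?sqr_ge0//.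
  by rewrite lef_pV2 ?posrE ?mulr_gt0 ?exprn_gt0// ler_pM2r ?exprn_gt0// ler_nat.
apply: (@le_trans _ _ (4 * expR (- (t ^+ 2 / (64 * spread x ^+ 2))))%:E); last first.
  by rewrite lee_fin ler_pM2l.
set e := expR (- (t ^+ 2 / (64 * _))).
have tail (p q : R) : 2^-1 <= p / N`!%:R -> p * q <= N`!%:R ^+ 2 * e -> q / N`!%:R <= 2 * e.
  have : 0 < N`!%:R :> R by rewrite ltr0n fact_gt0.
  move: N`!%:R => f f0; rewrite ler_pdivlMr// ler_pdivrMr// => hp hq.
  have e0 : 0 < e := expR_gt0 _.
  have p0 : 0 < p by nra.
  rewrite -(ler_pM2l p0); apply: le_trans hq _; rewrite -subr_ge0.
  have -> : p * (2 * e * f) - f ^+ 2 * e = e * f * (2 * p - f) by ring.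
  by rewrite mulr_ge0 ?(mulr_ge0 (ltW e0) (ltW f0))//; lra.
have tailZ := perm_lambda_max_tail n0 xs ax spread0.
apply: (@le_trans _ _ (P ([set w | m + t <= Z w] `|` [set w | Z w <= m - t]))).
  apply: le_measure; rewrite ?inE.
  - rewrite -[X in measurable X]setTI.
    apply: (@measurable_realfun.measurable_fun_ler _ _ R setT (fun=> t)
      (fun w => `|Z w - m|)) => //.
    apply: measurableT_comp; first exact: measurable_realfun.normr_measurable.
    exact: measurable_realfun.measurable_funB.
  - exact: measurableU.
  - move=> w /=; rewrite -/(Z w) ler_normr => /orP[H|H]; [left|right] => /=; lra.
apply: le_trans (measureU2 _ _ _) _ => //.
have -> : 4 * e = 2 * e + 2 * e by ring.
rewrite EFinD; apply: leeD.
  apply: le_trans (Pge _) _; rewrite lee_fin.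
  apply: tail (tailZ m t t0).
  by rewrite -lee_fin; exact: le_trans medl (Ple m).
apply: le_trans (Ple _) _; rewrite lee_fin.
apply: (@tail #|[set s | m <= F s]%SET|%:R).
  by rewrite -lee_fin; exact: le_trans medr (Pge m).
by have := tailZ (m - t) t t0; rewrite subrK mulrC.
Qed.
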